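(* Let $k\ge 2$ and let $X$ be the algebraic toric set over $K=\mathbb{F}_q$ associated to an even order cycle $\mathcal{G}=\mathcal{C}_{2k}$ (with $2k$ vertices and $s=2k$ edges). Then $\operatorname{reg} S/I(X)=(q-2)(k-1)$.
   Context: $K=\mathbb{F}_q$ is a finite field with $q>2$ elements, $K^*=K\setminus\{0\}$, and $\mathbb{P}^{s-1}$ is the projective space of dimension $s-1$ over $K$. For a simple graph $\mathcal{G}$ with vertices $v_1,\dots,v_n$ and edges $e_1,\dots,e_s$, for $\mathbf{x}\in(K^* )^n$ and $e_i=\{v_j,v_l\}$ put $\mathbf{x}^{e_i}=x_jx_l$. The algebraic toric set associated to $\mathcal{G}$ is $X=\{[(\mathbf{x}^{e_1},\dots,\mathbf{x}^{e_s})]:\mathbf{x}\in(K^* )^n\}\subset\mathbb{P}^{s-1}$, and $I(X)\subset S=K[t_1,\dots,t_s]$ (standard grading) is the ideal generated by the homogeneous polynomials vanishing on $X$. The Hilbert function is $H_X(d)=\dim_K(S/I(X))_d$; the Hilbert polynomial $h_X$ of $S/I(X)$ is the constant $|X|$. The regularity $\operatorname{reg} S/I(X)$ is the least integer $\ell\ge0$ such that $H_X(d)=h_X(d)$ for all $d\ge\ell$ (it coincides with the Castelnuovo–Mumford regularity of $S/I(X)$). *)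

(* Defs.v *)
From mathcomp Require Import all_boot all_order all_fingroup all_algebra.
From mathcomp Require Import mpoly.
From Stdlib Require Import ClassicalEpsilon.

Set Implicit Arguments.
Unset Strict Implicit.
Unset Printing Implicit Defensive.

Import GRing.Theory Num.Theory.
Local Open Scope ring_scope.

(* Vertices v_j are indexed by 'I_n and edges e_i by 'I_s, in arbitrary order. *)
Record simple_graph (n s : nat) := SimpleGraph {
  edge :> 'I_s -> {set 'I_n};
  card_edge : forall i, #|edge i| = 2%N;
  edge_inj : injective edge }.

(* Here ordS is the successor modulo n. The permutation c allows every labelling
   of the vertices; comparing sets of edges allows every numbering of these. *)
Definition is_cycle (n s : nat) (G : simple_graph n s) : Prop :=
  (2 < n)%N /\
  exists c : {perm 'I_n},
    [set G i | i : 'I_s] = [set [set c j; c (ordS j)] | j : 'I_n].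

(* P^r over K, as the set of lines through the origin of K^(r+1). *)
Definition proj_space (K : fieldType) (r : nat) : Type :=
  {L : {vspace 'rV[K]_r.+1} | \dim L == 1%N}.

Definition edge_monomial (K : fieldType) (n s : nat) (G : simple_graph n s)
    (x : 'I_n -> K) : 'rV[K]_s :=
  \row_i \prod_(j in G i) x j.

(* The homogeneous coordinates [(y_1, ..., y_s)] denote the line <[y]>. *)
Definition toric_set (K : fieldType) (n r : nat) (G : simple_graph n r.+1)
    (P : proj_space K r) : Prop :=
  exists2 x : 'I_n -> K,
    forall j, x j != 0 & sval P = <[edge_monomial G x]>%VS.

Definition vanishes_on (K : fieldType) (r : nat) (X : proj_space K r -> Prop)
    (f : {mpoly K[r.+1]}) : Prop :=
  forall P, X P -> forall y, y \in sval P -> y != 0 -> f.@[fun i => y 0 i] = 0.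

Definition ideal_generated (R : comNzRingType) (A : R -> Prop) (f : R) : Prop :=
  exists (m : nat) (a g : 'I_m -> R),
    (forall i, A (g i)) /\ f = \sum_i a i * g i.

Definition vanishing_ideal (K : fieldType) (r : nat)
    (X : proj_space K r -> Prop) : {mpoly K[r.+1]} -> Prop :=
  ideal_generated
    (fun f => (exists d, f \is d.-homog) /\ vanishes_on X f).

(* The subspace I_d = I :&: S_d of S_d, where S_d is dhomog r.+1 K d; see
   graded_pieceP. *)
Definition graded_piece (K : fieldType) (r : nat) (I : {mpoly K[r.+1]} -> Prop)
    (d : nat) : {vspace dhomog r.+1 K d} :=
  epsilon (inhabits 0%VS)
    (fun U => forall f : dhomog r.+1 K d, f \in U <-> I f).

(* dim_K (S/I)_d, where (S/I)_d = S_d / I_d. *)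
Definition hilbert_function (K : fieldType) (r : nat)
    (I : {mpoly K[r.+1]} -> Prop) (d : nat) : nat :=
  (\dim {: dhomog r.+1 K d} - \dim (graded_piece I d))%N.

Definition agree_from (H : nat -> nat) (p : {poly rat}) (l : nat) : Prop :=
  forall d, (l <= d)%N -> (H d)%:R = p.[d%:R].

Definition is_hilbert_polynomial (H : nat -> nat) (p : {poly rat}) : Prop :=
  exists l, agree_from H p l.

(* "reg S/I = l"; the Hilbert polynomial is unique by hilbert_polynomial_unique. *)
Definition is_regularity (K : fieldType) (r : nat)
    (I : {mpoly K[r.+1]} -> Prop) (l : nat) : Prop :=
  exists p : {poly rat},
    [/\ is_hilbert_polynomial (hilbert_function I) p,
        agree_from (hilbert_function I) p l
      & forall l', agree_from (hilbert_function I) p l' -> (l <= l')%N].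

Lemma subspaceP (K : fieldType) (V : vectType K) (W : V -> Prop) :
    W 0 -> (forall a u v, W u -> W v -> W (a *: u + v)) ->
  exists U : {vspace V}, forall v, v \in U <-> W v.
Proof.
move=> W0 WL.
suff H : forall m (U : {vspace V}), (\dim {:V} - \dim U <= m)%N ->
    (forall v, v \in U -> W v) ->
    exists U : {vspace V}, forall v, v \in U <-> W v.
  apply: (H (\dim {:V}) 0%VS); first exact: leq_subr.
  by move=> v; rewrite memv0 => /eqP->.
elim=> [|m IHm] U leUm sUW.
  exists U => v; split; first exact: sUW.
  have /eqP -> : U == fullv by rewrite eqEdim subvf -subn_eq0 -leqn0.
  by rewrite memvf.
case: (classic (exists2 v, W v & v \notin U)) => [[v Wv nUv]|nE].
  apply: (IHm (<[v]> + U)%VS).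
    have ltU : (\dim U < \dim (<[v]> + U))%N.
      rewrite ltnNge; apply: contra nUv => le.
      have /eqP -> : U == (<[v]> + U)%VS by rewrite eqEdim addvSr.
      exact: (subvP (addvSl _ U) _ (memv_line v)).
    have leV := dimvS (subvf (<[v]> + U)%VS).
    by rewrite -ltnS (leq_trans _ leUm) // ltn_sub2l // (leq_trans ltU).
  move=> w /memv_addP [_ /vlineP [a ->]] [u Uu ->].
  by apply: WL => //; apply: sUW.
exists U => v; split; first exact: sUW.
by move=> Wv; case: (boolP (v \in U)) => // nUv; case: nE; exists v.
Qed.

Lemma ideal_generated0 (R : comNzRingType) (A : R -> Prop) :
  ideal_generated A 0.
Proof.
exists 0%N, (fun=> 0), (fun=> 0); split; first by case.
by rewrite big_ord0.
Qed.

Lemma ideal_generatedMD (R : comNzRingType) (A : R -> Prop) (a f g : R) :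
  ideal_generated A f -> ideal_generated A g -> ideal_generated A (a * f + g).
Proof.
case=> [m [b [u [Au ->]]]] [m' [b' [u' [Au' ->]]]].
pose pick T (h : 'I_m -> T) (h' : 'I_m' -> T) i :=
  match split i with inl j => h j | inr j => h' j end.
exists (m + m')%N, (pick R (fun i => a * b i) b'), (pick R u u'); split.
  by move=> i; rewrite /pick; case: (split i).
rewrite big_split_ord mulr_sumr /=; congr (_ + _); apply: eq_bigr => i _.
  by rewrite /pick (unsplitK (inl i)) mulrA.
by rewrite /pick (unsplitK (inr i)).
Qed.

Lemma graded_pieceP (K : fieldType) (r : nat) (X : proj_space K r -> Prop)
    (d : nat) (f : dhomog r.+1 K d) :
  f \in graded_piece (vanishing_ideal X) d <-> vanishing_ideal X f.
Proof.
apply: (epsilon_spec (inhabits 0%VS) (fun U : {vspace dhomog r.+1 K d} =>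
  forall f : dhomog r.+1 K d, f \in U <-> vanishing_ideal X f)).
apply: (@subspaceP _ _ (fun f : dhomog r.+1 K d => vanishing_ideal X f)).
  exact: ideal_generated0.
move=> a u v Iu Iv; rewrite linearP /= -mul_mpolyC.
exact: ideal_generatedMD.
Qed.

Lemma hilbert_polynomial_unique (H : nat -> nat) (p q : {poly rat}) :
  is_hilbert_polynomial H p -> is_hilbert_polynomial H q -> p = q.
Proof.
case=> [l Hp] [l' Hq]; apply/eqP; rewrite -subr_eq0; apply/negPn/negP => nz.
pose rs : seq rat := [seq (maxn l l' + i)%:R | i <- iota 0 (size (p - q))].
have : (size rs < size (p - q)%R)%N.
  apply: max_poly_roots => //.
    apply/allP => _ /mapP [i _ ->]; rewrite rootE !hornerE.
    rewrite -Hp ?(leq_trans (leq_maxl l l')) ?leq_addr //.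
    by rewrite -Hq ?(leq_trans (leq_maxr l l')) ?leq_addr // subrr.
  rewrite map_inj_uniq ?iota_uniq // => i j /eqP.
  by rewrite eqr_nat eqn_add2l => /eqP.
by rewrite size_map size_iota ltnn.
Qed.

(* Main.v *)
(* Choose the representative with first coordinate 1 of each point of X. Then
   H_X(d) is the rank of the evaluation of the forms of degree d at these points,
   so the regularity is the least degree from which this evaluation is onto.
   Write m = q - 1. The edges of the cycle split into two perfect matchings M, M', and
   the product of the coordinates of a point of X over M equals that over M'.

   Every function on finitely many points is a polynomial. Adding j to the
   exponents on M, subtracting j from those on M' and reducing modulo m does not
   change a monomial on X; the average degree over j < m is k (m - 1). Hence some
   representative has degree at most k (m - 1), and a degree congruent to d
   modulo m that exceeds d would be at least d + m > k (m - 1) as soon as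
   d >= (m - 1) (k - 1). Such a monomial is padded by a power of the first
   variable.

   In degree d = (m - 1) (k - 1) - 1 = k (m - 1) - m, the character given by the
   exponents m - 1 on M and 0 on M' is orthogonal to all monomials of degree d:
   a monomial that agrees with it has total exponent at least m - 1 around each
   of the 2 k vertices, hence degree at least k (m - 1). *)
Require Import Defs.
From HB Require Import structures.
From mathcomp Require Import all_boot all_order all_fingroup all_algebra.
From mathcomp Require Import finfield zify mpoly.

Set Implicit Arguments.
Unset Strict Implicit.
Unset Printing Implicit Defensive.

Import GRing.Theory.
Local Open Scope ring_scope.

(** * The Hilbert function as the rank of evaluation *)

Lemma meval_homogZ (R : comNzRingType) (n d : nat) (f : {mpoly R[n]}) (a : R)
    (v : 'I_n -> R) :
  f \is d.-homog -> f.@[fun i => a * v i] = a ^+ d * f.@[v].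
Proof.
move=> /dhomogP fd; rewrite !mevalE mulr_sumr; apply: eq_big_seq => m /fd /= <-.
rewrite mulrCA mdegE -prodrXr -big_split /=; congr (_ * _).
by apply: eq_bigr => i _; rewrite exprMn.
Qed.

Section Evaluation.

Variables (K : fieldType) (r : nat) (T : finType) (pt : T -> 'rV[K]_r.+1).

Definition evalh (d : nat) (f : dhomog r.+1 K d) : {ffun T -> K^o} :=
  [ffun t => (mpoly_of_dhomog f).@[fun i => pt t 0 i]].

Fact evalh_linear d : linear (@evalh d).
Proof.
move=> a f g; apply/ffunP=> t.
by rewrite !ffunE linearP.
Qed.

HB.instance Definition _ d := GRing.isLinear.Build K (dhomog r.+1 K d)
  {ffun T -> K^o} *:%R (@evalh d) (@evalh_linear d).

Variable X : proj_space K r -> Prop.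
Hypothesis pt_neq0 : forall t, pt t != 0.
Hypothesis XE : forall P, X P <-> exists t, sval P = <[pt t]>%VS.

(** A form scales by a power along each line, so vanishing at one representative suffices;
    conversely, the elements of the ideal vanish at the points because its generators do. *)
Lemma homog_vanishing_idealP (d : nat) (f : {mpoly K[r.+1]}) :
  f \is d.-homog ->
  (vanishing_ideal X f <-> forall t, f.@[fun i => pt t 0 i] = 0).
Proof.
move=> fd; split=> [[m [a [g [gX ->]]]] t | f0].
  have Pd : \dim <[pt t]> == 1%N by rewrite dim_vline pt_neq0.
  pose P : proj_space K r := exist (fun L => \dim L == 1%N) <[pt t]>%VS Pd.
  rewrite raddf_sum big1 //= => i _; rewrite mevalM.
  have [_ gX0] := gX i; rewrite (gX0 P) ?mulr0 ?memv_line //.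
  by apply/XE; exists t.
exists 1%N, (fun=> 1), (fun=> f); split; last by rewrite big_ord1 mul1r.
move=> _; split; first by exists d.
move=> P /XE[t ->] y /vlineP[a ->] _.
rewrite (_ : meval _ _ = f.@[fun i => a * pt t 0 i]).
  by rewrite (meval_homogZ _ _ fd) f0 mulr0.
by apply: meval_eq => i; rewrite mxE.
Qed.

(** The degree-[d] piece of the ideal is the kernel of evaluation, so rank-nullity applies. *)
Lemma hilbert_function_rank d :
  hilbert_function (vanishing_ideal X) d = \dim (limg (linfun (@evalh d))).
Proof.
rewrite /hilbert_function -(limg_ker_dim (linfun (@evalh d)) fullv) capfv.
suff -> : graded_piece (vanishing_ideal X) d = lker (linfun (@evalh d)).
  by rewrite addKn.
apply/vspaceP => f; rewrite memv_ker lfunE /=; apply/idP/eqP.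
  move/graded_pieceP/(homog_vanishing_idealP (valP f)) => f0.
  by apply/ffunP => t; rewrite !ffunE f0.
move=> /ffunP f0; apply/graded_pieceP/(homog_vanishing_idealP (valP f)) => t.
by have := f0 t; rewrite !ffunE.
Qed.

Lemma hilbert_function_full d :
    (forall F : {ffun T -> K},
     exists2 f : {mpoly K[r.+1]}, f \is d.-homog
       & forall t, f.@[fun i => pt t 0 i] = F t) ->
  hilbert_function (vanishing_ideal X) d = \dim {: {ffun T -> K^o}}.
Proof.
move=> evX; rewrite hilbert_function_rank; congr (\dim _); apply/vspaceP => F.
rewrite memvf; apply/memv_imgP; have [f fd fF] := evX F.
exists (DHomog fd); first exact: memvf.
by apply/ffunP => t; rewrite lfunE ffunE fF.
Qed.

(** [w] is a linear functional that kills the image of evaluation but not the indicator of [t0]. *)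
Lemma hilbert_function_not_full d (w : T -> K) (t0 : T) :
    w t0 != 0 ->
    (forall m : 'X_{1..r.+1}, mdeg m = d ->
     \sum_t w t * 'X_[m].@[fun i => pt t 0 i] = 0) ->
  hilbert_function (vanishing_ideal X) d <> \dim {: {ffun T -> K^o}}.
Proof.
move=> w0 wX; rewrite hilbert_function_rank => eqd.
have imgT : limg (linfun (@evalh d)) = fullv.
  by apply/eqP; rewrite eqEdim subvf eqd leqnn.
pose F : {ffun T -> K^o} := [ffun t => (t == t0)%:R].
have : F \in limg (linfun (@evalh d)) by rewrite imgT memvf.
case/memv_imgP => f _ eF; case/negP: w0; apply/eqP.
transitivity (\sum_t w t * F t).
  rewrite (bigD1 t0) //= ffunE eqxx mulr1 big1 ?addr0 // => t /negPf t_t0.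
  by rewrite ffunE t_t0 mulr0.
rewrite eF lfunE /=.
under eq_bigr do rewrite ffunE [X in meval _ X]mpolyE raddf_sum mulr_sumr /=.
rewrite exchange_big big_seq big1 //= => m fm.
under eq_bigr do rewrite mevalZ mulrCA.
by rewrite -mulr_sumr wX ?mulr0 //; exact: (dhomogP _ _ _ (valP f) m fm).
Qed.

End Evaluation.

(** * Polynomial functions over a finite field *)

Section FiniteField.

Variable K : finFieldType.

Lemma expf_card_pred (x : K) : x != 0 -> x ^+ #|K|.-1 = 1.
Proof.
move=> nz_x; apply: (mulfI nz_x).
by rewrite -exprS (ltn_predK (finNzRing_gt1 K)) expf_card mulr1.
Qed.

(** All nonzero elements are roots of [X ^ t - 1], which has at most [t] roots. *)
Lemma expf_eq1_leq (t : nat) :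
  (0 < t)%N -> (forall x : K, x != 0 -> x ^+ t = 1) -> (#|K|.-1 <= t)%N.
Proof.
move=> t_gt0 xt; rewrite -(cardC1 (0 : K)) cardE.
apply: max_unity_roots => //; last exact: enum_uniq.
by apply/allP => x; rewrite mem_enum unity_rootE => /xt/eqP.
Qed.

Lemma mpoly_interpolation (n : nat) (T : finType) (pt : T -> 'rV[K]_n)
    (F : T -> K) :
  injective pt ->
  exists f : {mpoly K[n]}, forall t, f.@[fun i => pt t 0 i] = F t.
Proof.
move=> pt_inj.
(* By Fermat, the factor of index [i] is 1 where coordinate [i] agrees with that of [pt p] and 0
   elsewhere, so [delta p] is the indicator of [pt p]. *)
pose delta (p : T) : {mpoly K[n]} :=
  \prod_i (1 - ('X_i - (pt p 0 i)%:MP) ^+ #|K|.-1).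
exists (\sum_p F p *: delta p) => t.
rewrite raddf_sum (bigD1 t) //= big1 => [|p p_t].
  rewrite mevalZ rmorph_prod /= big1 ?mulr1 ?addr0 // => i _.
  rewrite mevalB meval1 rmorphXn /= mevalB mevalXU mevalC subrr.
  rewrite expr0n; case: #|K| (finNzRing_gt1 K) => [|[|q]] //= _.
  by rewrite subr0.
rewrite mevalZ rmorph_prod /=.
case: (pickP (fun i => pt p 0 i != pt t 0 i)) => [i p_ti | p_eqt].
  rewrite (bigD1 i) //= mevalB meval1 rmorphXn /= mevalB mevalXU mevalC.
  by rewrite expf_card_pred ?subrr ?mul0r ?mulr0 // subr_eq0 eq_sym.
case/eqP: p_t; apply/pt_inj/rowP => i.
by apply/eqP; rewrite -[_ == _]negbK p_eqt.
Qed.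

End FiniteField.

(** * Sums of residues and of characters *)

Lemma sum_modn_shift (m a : nat) :
  (\sum_(j < m) (a + j) %% m = \sum_(j < m) j)%N.
Proof.
case: m => [|m]; first by rewrite !big_ord0.
pose h (j : 'I_m.+1) : 'I_m.+1 := Ordinal (ltn_pmod (a + j) (ltn0Sn m)).
rewrite [RHS](reindex_inj (h := h)) // => i j [] /eqP.
by rewrite eqn_modDl !modn_small // => /eqP/val_inj.
Qed.

Lemma sum_modn_rev_shift (m a : nat) :
  (\sum_(j < m) (a + (m - j)) %% m = \sum_(j < m) j)%N.
Proof.
rewrite -(sum_modn_shift _ a.+1) (reindex_inj rev_ord_inj).
by apply: eq_bigr => j _; rewrite /= subKn // addSnnS.
Qed.

Lemma sum_ord_double (m : nat) : (2 * \sum_(j < m) j = m * m.-1)%N.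
Proof.
elim: m => [|m IHm]; first by rewrite big_ord0.
by rewrite big_ord_recr mulnDr IHm; case: m {IHm} => //= m; lia.
Qed.

(* Over a full period j < m each residue averages (m - 1) / 2, so some shift has
   total weight at most the average. *)
Lemma exists_light_shift (I : finType) (M : pred I) (m k : nat)
    (a : I -> nat) :
    (0 < m)%N -> #|I| = (2 * k)%N ->
  exists j : 'I_m,
    (\sum_i (a i + (if M i then nat_of_ord j else m - j)) %% m <= k * m.-1)%N.
Proof.
move=> m_gt0 cardI; apply/existsP; apply: contraT; rewrite negb_exists.
move=> /forallP big_shift.
have : (\sum_(j < m) (k * m.-1).+1 <= \sum_(j < m) \sum_i
          (a i + (if M i then nat_of_ord j else m - j)) %% m)%N.
  by apply: leq_sum => j _; rewrite ltnNge big_shift.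
rewrite exchange_big sum_nat_const card_ord /=.
rewrite (eq_bigr (fun=> \sum_(j < m) j)%N) => [|i _].
  by rewrite sum_nat_const cardI; have := sum_ord_double m; nia.
by case: (M i); rewrite ?sum_modn_shift ?sum_modn_rev_shift.
Qed.

(** Reindexing by [h] multiplies the sum by [a]. For a character and a translation [h], this is the
    orthogonality relation. *)
Lemma sumr_eq0_of_quasi_invariant (F : idomainType) (I : finType)
    (psi : I -> F) (h : I -> I) (a : F) :
    injective h -> a != 1 -> (forall t, psi (h t) = a * psi t) ->
  \sum_t psi t = 0.
Proof.
move=> h_inj a1 psih; apply/eqP.
have : (a - 1) * (\sum_t psi t) == 0.
  rewrite mulrBl mul1r subr_eq0 mulr_sumr; apply/eqP.
  by rewrite [RHS](reindex_inj h_inj); apply: eq_bigr.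
by rewrite mulf_eq0 subr_eq0 (negPf a1).
Qed.

(** * Perfect matchings and bipartition of an even cycle *)

Lemma odd_ordS (n : nat) (j : 'I_n) : ~~ odd n -> odd (ordS j) = ~~ odd j.
Proof. by move=> /negPf n_even; rewrite /= odd_mod. Qed.

Definition perfect_matching (n s : nat) (G : simple_graph n s)
    (M : pred 'I_s) :=
  forall v, #|[pred i | M i & v \in G i]| = 1%N.

(* M takes every other edge, and A is one side of the bipartition. *)
Lemma cycle_matching (n : nat) (G : simple_graph n n) :
    is_cycle G -> ~~ odd n ->
  exists (M : pred 'I_n) (A : {set 'I_n}),
    [/\ perfect_matching G M, perfect_matching G (predC M)
      & forall i, #|G i :&: A| = 1%N].
Proof.
case=> n_gt2 [c eqG] n_even.
(* The edges of [G] are distinct, so they form a set of [n] elements; a map from ['I_n] onto this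
   set is injective. *)
have f_inj : injective (fun j => [set c j; c (ordS j)]).
  suff /imset_injP f_inj : #|[set [set c j; c (ordS j)] | j : 'I_n]| == #|'I_n|.
    by move=> i j; apply: f_inj.
  by rewrite -eqG card_imset //; apply: edge_inj.
have eP j : exists i, G i == [set c j; c (ordS j)].
  have : [set c j; c (ordS j)] \in [set G i | i : 'I_n].
    by rewrite eqG; apply: imset_f.
  by case/imsetP => i _ ->; exists i.
(* [e0] lists the edges in their order along the cycle. *)
pose e0 j := xchoose (eP j).
have Ge0 j : G (e0 j) = [set c j; c (ordS j)] by apply/eqP/(xchooseP (eP j)).
have e_inj : injective e0.
  by move=> i j eij; apply: f_inj; rewrite -!Ge0 eij.
pose e := perm e_inj.
have Ge j : G (e j) = [set c j; c (ordS j)] by rewrite permE.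
have predE (w j : 'I_n) : (w == ordS j) = (ord_pred w == j).
  by apply/eqP/eqP => [-> | <-]; rewrite ?ordSK ?ord_predK.
have odd_pred (w : 'I_n) : odd (ord_pred w) = ~~ odd w.
  have := odd_ordS (ord_pred w) n_even.
  by rewrite ord_predK => ->; rewrite negbK.
(* The edges at the vertex in position [w] have positions [w] and [ord_pred w], of opposite parity
   because [n] is even; each parity class thus contains exactly one. *)
have one_edge b v : #|[pred i | (odd ((e^-1)%g i) == b) & v \in G i]| = 1%N.
  rewrite -(permKV c v); set w := (c^-1)%g v.
  rewrite -(card1 (e (if odd w == b then w else ord_pred w))).
  apply: eq_card => i; rewrite !inE -(permKV e i); set j := (e^-1)%g i.
  rewrite permK Ge !inE !(inj_eq perm_inj) predE ![_ == j]eq_sym.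
  have w_pw : (w == ord_pred w) = false.
    by apply/eqP => ew; have := odd_pred w; rewrite -ew; case: (odd w).
  case: (eqVneq j w) => [-> | j_w].
    by rewrite andbT; case: (odd w == b); [rewrite eqxx | exact: (esym w_pw)].
  case: (eqVneq j (ord_pred w)) => [-> | j_pw].
    have pw_w : (ord_pred w == w) = false by rewrite eq_sym.
    by rewrite odd_pred andbT; case: (odd w) b => [] []; rewrite /= ?eqxx ?pw_w.
  by rewrite andbF; case: ifP => _; apply/esym/negbTE.
exists (fun i => odd ((e^-1)%g i)), [set v | odd ((c^-1)%g v)]; split.
- move=> v; rewrite -(one_edge true v).
  by apply: eq_card => i; rewrite !inE eqb_id.
- move=> v; rewrite -(one_edge false v).
  by apply: eq_card => i; rewrite !inE eqbF_neg.
move=> i; rewrite -(permKV e i); set j := (e^-1)%g i; rewrite Ge.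
rewrite -(cards1 (c (if odd j then j else ordS j))).
apply: eq_card => v; rewrite !inE -(permKV c v); set w := (c^-1)%g v.
rewrite permK !(inj_eq perm_inj); have oddS := odd_ordS j n_even.
have j_S : (j == ordS j) = false.
  by apply/eqP => ej; move: oddS; rewrite -ej; case: (odd j).
case: (eqVneq w j) => [-> | w_j].
  by case: (odd j); rewrite ?eqxx ?j_S.
case: (eqVneq w (ordS j)) => [-> | w_S].
  by rewrite oddS; case: (odd j); rewrite /= ?eqxx // eq_sym j_S.
by case: ifP => _; apply/esym/negbTE.
Qed.

(** * Monomials in the coordinates of the parametrisation *)

Section EdgeMonomial.

Variables (K : fieldType) (n s : nat) (G : simple_graph n s).
Implicit Types (x : 'I_n -> K) (a : 'I_s -> nat).

Lemma edge_monomial_neq0 x i :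
  (forall v, x v != 0) -> edge_monomial G x 0 i != 0.
Proof. by move=> nz_x; rewrite mxE; apply/prodf_neq0. Qed.

Lemma edge_monomialM x y i :
  edge_monomial G (fun v => x v * y v) 0 i =
    edge_monomial G x 0 i * edge_monomial G y 0 i.
Proof. by rewrite !mxE big_split. Qed.

Lemma edge_monomial_monomial x a :
  \prod_i edge_monomial G x 0 i ^+ a i =
    \prod_v x v ^+ (\sum_(i | v \in G i) a i).
Proof.
under eq_bigr do rewrite mxE -prodrXl.
rewrite (exchange_big_dep xpredT) //=.
by apply: eq_bigr => v _; rewrite prodrXr.
Qed.

Lemma handshake a :
  (\sum_v \sum_(i | v \in G i) a i = 2 * \sum_i a i)%N.
Proof.
rewrite (exchange_big_dep xpredT) //= big_distrr /=.
by apply: eq_bigr => i _; rewrite sum_nat_const card_edge.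
Qed.

(** Each edge meets [A] once, so scaling [x] on [A] scales every coordinate alike: rescaled
    representatives stay parametrised. *)
Lemma edge_monomial_transversal (A : {set 'I_n}) x (u : K) i :
  #|G i :&: A| = 1%N ->
  edge_monomial G (fun v => if v \in A then u * x v else x v) 0 i =
    u * edge_monomial G x 0 i.
Proof.
move=> GA; rewrite !mxE.
have -> : \prod_(v in G i) (if v \in A then u * x v else x v) =
    \prod_(v in G i) ((if v \in A then u else 1) * x v).
  by apply: eq_bigr => v _; case: ifP; rewrite ?mul1r.
rewrite big_split /= -big_mkcondr /= (eq_bigl (mem (G i :&: A))) => [|v].
  by rewrite prodr_const GA.
by rewrite !inE.
Qed.

(** Each vertex lies on exactly one edge of [M]. Applied to both matchings, this gives the relation
    between the coordinates. *)
Lemma edge_monomial_matching (M : pred 'I_s) x :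
  perfect_matching G M -> \prod_(i | M i) edge_monomial G x 0 i = \prod_v x v.
Proof.
move=> hM; under eq_bigr do rewrite mxE.
rewrite (exchange_big_dep xpredT) //=; apply: eq_bigr => v _.
by rewrite prodr_const (hM v).
Qed.

Lemma card_perfect_matching (M : pred 'I_s) :
  perfect_matching G M -> (2 * #|M| = n)%N.
Proof.
move=> hM; have := handshake (fun i => nat_of_bool (M i)).
have -> : (\sum_i M i = #|M|)%N.
  rewrite -sum1_card [RHS]big_mkcond; apply: eq_bigr => i _.
  by rewrite -topredE /=; case: (M i).
move=> <-; transitivity (\sum_(v < n) 1)%N; last first.
  by rewrite sum_nat_const card_ord muln1.
apply: eq_bigr => v _; rewrite -(hM v) -sum1_card big_mkcond [RHS]big_mkcond.
by apply: eq_bigr => i _; rewrite inE; case: (M i); case: (v \in G i).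
Qed.

End EdgeMonomial.

(** * Normalised points of the toric set, and forms of large degree on them *)

Section ToricPoints.

Variables (K : finFieldType) (n r : nat) (G : simple_graph n r.+1).

(** Taking [x] among finite functions makes the condition boolean, so that the points below form a
    finite type. *)
Definition on_torus (y : 'rV[K]_r.+1) :=
  [exists x : {ffun 'I_n -> K},
     [forall v, x v != 0] && (y == edge_monomial G x)].

Lemma on_torusP (y : 'rV[K]_r.+1) :
  reflect (exists2 x : 'I_n -> K, forall v, x v != 0 & y = edge_monomial G x)
          (on_torus y).
Proof.
apply: (iffP existsP) => [[x /andP[/forallP nz_x /eqP->]] | [x nz_x ->]].
  by exists x.
exists [ffun v => x v]; apply/andP; split.
  by apply/forallP => v; rewrite ffunE.
apply/eqP/rowP => i; rewrite !mxE.
by apply: eq_bigr => v _; rewrite ffunE.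
Qed.

Definition toric_point := {y : 'rV[K]_r.+1 | on_torus y && (y 0 0 == 1)}.

Lemma toric_point_torus (t : toric_point) :
  exists2 x : 'I_n -> K, forall v, x v != 0 & val t = edge_monomial G x.
Proof. by have /andP[/on_torusP] := valP t. Qed.

Lemma toric_point0 (t : toric_point) : val t 0 0 = 1.
Proof. by have /andP[_ /eqP] := valP t. Qed.

Lemma toric_point_coord_neq0 (t : toric_point) i : val t 0 i != 0.
Proof.
by have [x nz_x ->] := toric_point_torus t; apply: edge_monomial_neq0.
Qed.

Lemma toric_point_neq0 (t : toric_point) : val t != 0.
Proof.
apply: contraNneq (toric_point_coord_neq0 t 0) => ->.
by rewrite mxE.
Qed.

Fact toric_point_mul_subproof (t u : toric_point) :
  let y := \row_i (val t 0 i * val u 0 i) in on_torus y && (y 0 0 == 1).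
Proof.
rewrite /= mxE !toric_point0 mulr1 eqxx andbT; apply/on_torusP.
have [x nz_x ->] := toric_point_torus t.
have [z nz_z ->] := toric_point_torus u.
exists (fun v => x v * z v); first by move=> v; rewrite mulf_neq0.
by apply/rowP => i; rewrite edge_monomialM mxE.
Qed.

(** The group law of the torus; its translations serve to reindex character sums. *)
Definition toric_point_mul (t u : toric_point) : toric_point :=
  Sub (\row_i (val t 0 i * val u 0 i)) (toric_point_mul_subproof t u).

Lemma toric_point_mul_inj t : injective (toric_point_mul t).
Proof.
move=> u v [/rowP eq_tuv]; apply/val_inj/rowP => i.
by have := eq_tuv i; rewrite !mxE => /(mulfI (toric_point_coord_neq0 t i)).
Qed.

Lemma normalized_toric_point (A : {set 'I_n}) (x : 'I_n -> K) :
    (forall i, #|G i :&: A| = 1%N) -> (forall v, x v != 0) ->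
  exists t : toric_point,
    forall i, edge_monomial G x 0 i = edge_monomial G x 0 0 * val t 0 i.
Proof.
move=> hA nz_x; set u := edge_monomial G x 0 0.
have nz_u : u != 0 by apply: edge_monomial_neq0.
pose z v := if v \in A then u^-1 * x v else x v.
have zE i : edge_monomial G z 0 i = u^-1 * edge_monomial G x 0 i.
  exact: edge_monomial_transversal.
have z_pt : on_torus (edge_monomial G z) && (edge_monomial G z 0 0 == 1).
  rewrite zE mulVf // eqxx andbT; apply/on_torusP; exists z => // v.
  by rewrite /z; case: ifP => _; rewrite ?mulf_neq0 ?invr_eq0.
by exists (Sub (edge_monomial G z) z_pt) => i; rewrite zE mulVKf.
Qed.

Lemma toric_setE (A : {set 'I_n}) (P : proj_space K r) :
    (forall i, #|G i :&: A| = 1%N) ->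
  toric_set G P <-> exists t : toric_point, sval P = <[val t]>%VS.
Proof.
move=> hA; split=> [[x nz_x ->] | [t Pt]]; last first.
  by have [x nz_x tx] := toric_point_torus t; exists x; rewrite // Pt tx.
have [t tE] := normalized_toric_point hA nz_x.
have nz_u : edge_monomial G x 0 0 != 0 by apply: edge_monomial_neq0.
exists t; set u := edge_monomial G x 0 0 in tE nz_u.
have -> : edge_monomial G x = u *: val t by apply/rowP => i; rewrite tE mxE.
apply/eqP; rewrite eqEsubv -!memvE memvZ ?memv_line //=.
by rewrite -{1}(scalerK nz_u (val t)) memvZ ?memv_line.
Qed.

Variable M : pred 'I_r.+1.
Hypotheses (hM : perfect_matching G M) (hM' : perfect_matching G (predC M)).

Lemma toric_point_matching (t : toric_point) :
  \prod_(i | M i) val t 0 i = \prod_(i | ~~ M i) val t 0 i.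
Proof.
have [x nz_x ->] := toric_point_torus t.
by rewrite edge_monomial_matching // (edge_monomial_matching (M := predC M)).
Qed.

Let m := #|K|.-1.

Lemma monomial_homogenize (k d : nat) (a : 'X_{1..r.+1}) :
    r.+1 = (2 * k)%N -> n = (2 * k)%N -> (m.-1 * k.-1 <= d)%N ->
  exists2 b : 'X_{1..r.+1}, mdeg b = d & forall t : toric_point,
    \prod_i val t 0 i ^+ b i = \prod_i val t 0 i ^+ a i.
Proof.
move=> r2k n2k led.
have m_gt0 : (0 < m)%N.
  by rewrite -ltnS prednK ?finNzRing_gt1 // ltnW ?finNzRing_gt1.
have k_gt0 : (0 < k)%N by case: k r2k {n2k led}.
(* The first variable is 1 at every point, so its exponent may grow freely; this choice makes the
   total congruent to [d] modulo [m]. *)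
pose a' (i : 'I_r.+1) := (a i + (i == 0%R) * (d + m.-1 * \sum_i a i))%N.
have sum_at0 : (\sum_(i < r.+1) (i == 0%R) = 1)%N.
  by rewrite (bigD1 0) //= big1 // => i /negPf->.
have sum_a' : (\sum_i a' i = d + m * \sum_i a i)%N.
  by rewrite big_split -big_distrl sum_at0 -[in RHS](prednK m_gt0) /=; lia.
have [j] := exists_light_shift M a' m_gt0 (etrans (card_ord _) r2k).
(* [m - j] stands for [- j] modulo [m] within the natural numbers. *)
pose c i := (a' i + (if M i then nat_of_ord j else m - j))%N.
rewrite -/c => light.
have sum_c : (\sum_i c i = d %[mod m])%N.
  (* Both matchings have [k] edges, so the shift adds [k * j + k * (m - j) = k * m] to the total. *)
  have hk N : perfect_matching G N -> #|N| = k.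
    by move/card_perfect_matching/eqP; rewrite n2k eqn_pmul2l // => /eqP.
  have sum_j : (\sum_i (if M i then nat_of_ord j else m - j) = k * m)%N.
    rewrite (bigID M) /= (eq_bigr (fun=> nat_of_ord j)) => [|i ->//].
    rewrite [X in (_ + X)%N](eq_bigr (fun=> (m - j)%N)) => [|i /negPf->//].
    rewrite !sum_nat_const (hk M) // (hk (predC M)) //.
    by rewrite -mulnDr subnKC // ltnW.
  rewrite big_split /= sum_a' sum_j -addnA addnC [(m * _)%N]mulnC -mulnDl.
  exact: modnMDl.
(* An excess over [d] is a multiple of [m], which would force a degree of at least
   [(m - 1) * (k - 1) + m = k * (m - 1) + 1], one more than [light] allows. *)
have deg_le : (\sum_i c i %% m <= d)%N.
  rewrite leqNgt; apply/negP => ltd.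
  have dvd : (m %| \sum_i c i %% m - d)%N.
    by rewrite -eqn_mod_dvd ?(ltnW ltd) // -sum_c modn_summ.
  have : (m <= \sum_i c i %% m - d)%N by apply: dvdn_leq; rewrite ?subn_gt0.
  rewrite leq_subRL ?(ltnW ltd) // => lew; have := leq_trans lew light.
  rewrite -{1}(prednK m_gt0) -{1}(prednK k_gt0) mulSn mulnC; lia.
pose e := (\sum_i c i %% m)%N.
exists [multinom (c i %% m + (i == 0%R) * (d - e))%N | i < r.+1].
  rewrite mdegE; under eq_bigr do rewrite mnmE.
  by rewrite big_split -big_distrl sum_at0 /= mul1n subnKC.
move=> t; set y := val t.
have y0E i (f : nat) : y 0 i ^+ ((i == 0%R) * f) = 1.
  by case: eqP => [->|_]; rewrite ?expr0 // toric_point0 expr1n.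
transitivity (\prod_i y 0 i ^+ c i).
  apply: eq_bigr => i _; rewrite mnmE exprD y0E mulr1.
  by rewrite expr_mod // expf_card_pred // toric_point_coord_neq0.
under eq_bigr do rewrite !exprD y0E mulr1.
rewrite big_split /= -[RHS]mulr1; congr (_ * _).
(* With [P] the common product of the coordinates over either matching, the shift contributes
   [P ^ j * P ^ (m - j) = P ^ m = 1]. *)
rewrite (bigID M) /= (eq_bigr (fun i => y 0 i ^+ j)) => [|i ->//].
rewrite [X in _ * X](eq_bigr (fun i => y 0 i ^+ (m - j))) => [|i /negPf->//].
rewrite !prodrXl toric_point_matching -exprD subnKC 1?ltnW //.
rewrite expf_card_pred //.
by apply/prodf_neq0 => i _; apply: toric_point_coord_neq0.
Qed.

End ToricPoints.

(** * Forms in the degree just below the bound *)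

Section LowDegree.

Variables (K : finFieldType) (n r : nat) (G : simple_graph n r.+1).
Variables (M : pred 'I_r.+1) (A : {set 'I_n}).
Hypothesis hM : perfect_matching G M.
Hypothesis hA : forall i, #|G i :&: A| = 1%N.
Let m := #|K|.-1.
Let c (i : 'I_r.+1) := (M i * m.-1)%N.

(* If the characters agreed, testing them at x = g on one vertex and 1 elsewhere
   would force the b-degree of every vertex to be -1 modulo m. *)
Lemma matching_monomial_separated (k d : nat) (b : 'X_{1..r.+1}) :
    n = (2 * k)%N -> (d + m = k * m.-1)%N -> mdeg b = d ->
  exists t : toric_point K G,
    \prod_i val t 0 i ^+ b i != \prod_i val t 0 i ^+ c i.
Proof.
move=> n2k dE bd; apply/existsP; apply: contraT; rewrite negb_exists.
move=> /forallP eq_bc.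
have m_gt0 : (0 < m)%N.
  by rewrite -ltnS prednK ?finNzRing_gt1 // ltnW ?finNzRing_gt1.
have deg_c v : (\sum_(i | v \in G i) c i = m.-1)%N.
  rewrite -big_distrl /= -[RHS]mul1n; congr (_ * _)%N.
  rewrite -(hM v) -sum1_card big_mkcond [RHS]big_mkcond.
  by apply: eq_bigr => i _; rewrite inE; case: (M i); case: (v \in G i).
have sum_c : (\sum_i c i = k * m.-1)%N.
  have := handshake G c; under eq_bigr do rewrite deg_c.
  rewrite sum_nat_const card_ord n2k -mulnA => /eqP.
  by rewrite eqn_pmul2l // => /eqP.
(* The equality on normalised points extends to all [x]: the scalar factor has exponent [d] on one
   side and [d + m] on the other, and its [m]-th power is 1. *)
have eq_torus (x : 'I_n -> K) : (forall v, x v != 0) ->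
    \prod_v x v ^+ (\sum_(i | v \in G i) b i) = \prod_v x v ^+ m.-1.
  move=> nz_x; have [t tE] := normalized_toric_point hA nz_x.
  have em_pow (a : 'I_r.+1 -> nat) :
      \prod_v x v ^+ (\sum_(i | v \in G i) a i) =
        edge_monomial G x 0 0 ^+ (\sum_i a i) * \prod_i val t 0 i ^+ a i.
    rewrite -edge_monomial_monomial -prodrXr -big_split /=.
    by apply: eq_bigr => i _; rewrite tE exprMn.
  transitivity (\prod_v x v ^+ (\sum_(i | v \in G i) c i)).
    rewrite !em_pow (eqP (negbNE (eq_bc t))) sum_c -dE exprD -mdegE bd.
    by rewrite expf_card_pred ?mulr1 ?edge_monomial_neq0.
  by apply: eq_bigr => v _; rewrite deg_c.
(* One plus the [b]-degree of [v] is a positive exponent that sends every nonzero [g] to 1, hence it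
   is at least [m]. *)
have deg_b v : (m.-1 <= \sum_(i | v \in G i) b i)%N.
  rewrite -ltnS prednK //; apply: (expf_eq1_leq (K := K)) => // g nz_g.
  have := eq_torus (fun w => if w == v then g else 1).
  have pow_v (a : 'I_n -> nat) :
      \prod_w (if w == v then g else 1) ^+ a w = g ^+ a v.
    rewrite (bigD1 v) //= eqxx big1 ?mulr1 // => w /negPf->.
    by rewrite expr1n.
  rewrite !pow_v exprS => ->.
    by rewrite -exprS prednK // expf_card_pred.
  by move=> w; case: ifP; rewrite ?oner_eq0.
(* Counting each edge at both ends gives [2 * d] at least [2 * k * (m - 1)], against
   [d + m = k * (m - 1)]. *)
have : (\sum_(v < n) m.-1 <= \sum_v \sum_(i | v \in G i) b i)%N.
  exact: leq_sum.
by rewrite handshake -mdegE bd sum_nat_const card_ord n2k; lia.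
Qed.

(** The summand is multiplicative in [t]; translation by the separating point [u] multiplies it by
    its value at [u], which is not 1. *)
Lemma matching_monomial_orthogonal (k d : nat) (b : 'X_{1..r.+1}) :
    n = (2 * k)%N -> (d + m = k * m.-1)%N -> mdeg b = d ->
  \sum_(t : toric_point K G)
    (\prod_i val t 0 i ^+ c i)^-1 * \prod_i val t 0 i ^+ b i = 0.
Proof.
move=> n2k dE bd; have [u u_bc] := matching_monomial_separated n2k dE bd.
apply: (sumr_eq0_of_quasi_invariant (@toric_point_mul_inj _ _ _ _ u)
  (a := (\prod_i val u 0 i ^+ c i)^-1 * \prod_i val u 0 i ^+ b i)).
  apply: contraNneq u_bc => /(canRL (mulVKf _)) -> //; first by rewrite mulr1.
  by apply/prodf_neq0 => i _; rewrite expf_neq0 ?toric_point_coord_neq0.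
move=> t; rewrite mulrACA -invfM -!big_split /=.
congr (_^-1 * _).
  by apply: eq_bigr => i _; rewrite mxE exprMn.
by apply: eq_bigr => i _; rewrite mxE exprMn.
Qed.

End LowDegree.

(* The two bounds on the regularity combined *)
Local Close Scope ring_scope.

(* The ambient projective space is P^r with r = s - 1. *)
Theorem theorem6p2 (K : finFieldType) (k n r : nat) (G : simple_graph n r.+1)
    (hq : 2 < #|K|) (hk : 2 <= k) (hn : n = 2 * k) (hs : r.+1 = 2 * k)
    (hG : is_cycle G) :
  is_regularity (vanishing_ideal (toric_set (K := K) G)) ((#|K| - 2) * (k - 1)).
Proof.
have n_even : ~~ odd n by rewrite hn mul2n odd_double.
have [M [A [hM hM' hA]]] : exists (M : pred 'I_r.+1) (A : {set 'I_n}),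
    [/\ perfect_matching G M, perfect_matching G (predC M)
      & forall i, #|G i :&: A| = 1].
  have en : n = r.+1 by rewrite hn hs.
  by clear hn; subst n; apply: cycle_matching.
pose pt (t : toric_point K G) : 'rV[K]_r.+1 := val t.
have pt_neq0 t : pt t != 0%R := toric_point_neq0 t.
have XE (P : proj_space K r) := toric_setE P hA.
have full d : (#|K| - 2) * (k - 1) <= d ->
    hilbert_function (vanishing_ideal (toric_set (K := K) G)) d =
      \dim {: {ffun toric_point K G -> K^o}}.
  move=> led; apply: (hilbert_function_full pt_neq0 XE) => F.
  have [f fF] := mpoly_interpolation F (val_inj : injective pt).
  (* Evaluation is linear, so the interpolating polynomial is made homogeneous one monomial at a
     time. *)
  suff [g gd fg] : exists2 g : {mpoly K[r.+1]}, g \is d.-homog &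
      forall t, meval (fun i => pt t 0%R i) g = meval (fun i => pt t 0%R i) f.
    by exists g => // t; rewrite fg fF.
  elim/mpolyind: f {fF} => [|a b f _ _ [g gd fg]].
    by exists 0%R; rewrite ?rpred0.
  have [|b' b'd b'E] := monomial_homogenize (K := K) hM hM' (d := d) b hs hn.
    by move: led; rewrite !subn1 subn2.
  exists (a *: 'X_[b'] + g)%R.
    by rewrite rpredD // rpredZ // dhomogX; apply/eqP.
  by move=> t; rewrite !mevalD !mevalZ !mevalX fg b'E.
exists ((\dim {: {ffun toric_point K G -> K^o}})%:R%:P)%R; split.
- by exists ((#|K| - 2) * (k - 1)) => d /full->; rewrite hornerC.
- by move=> d /full->; rewrite hornerC.
move=> l' agree; rewrite leqNgt; apply/negP => l'_lt.
(* The last degree below the claimed value, which is positive by [hq] and [hk], so the predecessor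
   is a true subtraction. *)
pose d := ((#|K| - 2) * (k - 1)).-1.
have dE : d + #|K|.-1 = k * #|K|.-2.
  rewrite /d.
  by case: #|K| hq k hk {hs hn full l'_lt d} => [|[|[|q]]] // _ [|[|k']] //; nia.
have /eqP : ((hilbert_function (vanishing_ideal (toric_set (K := K) G)) d)%:R =
    (\dim {: {ffun toric_point K G -> K^o}})%:R :> rat)%R.
  by rewrite agree ?hornerC // /d -ltnS (ltn_predK l'_lt).
rewrite Num.Theory.eqr_nat => /eqP full_d.
have [t0 _] := normalized_toric_point hA (fun=> @GRing.oner_neq0 K).
(* The weights are the inverse of the character with exponents [q - 2] on [M] and 0 elsewhere. *)
apply: (hilbert_function_not_full pt_neq0 XE (t0 := t0)
  (w := fun t => (\prod_i (pt t 0 i ^+ (M i * #|K|.-2)))^-1)%R) full_d.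
  rewrite GRing.invr_eq0; apply/prodf_neq0 => i _.
  by rewrite expf_neq0 ?toric_point_coord_neq0.
move=> b bd; under eq_bigr do rewrite mevalX.
exact: (matching_monomial_orthogonal hM hA hn dE).
Qed.
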